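(* Let $F$ be a field in which $2$ is invertible, and let $(V,B)$ be a formed space over $F$. For (images under the insertion $\iota$ of) vectors $a,b,c$ from $V$, the identity $$(ab)c+a(bc)=aB(b,c)-bB(c,a)+cB(a,b)$$ holds in the Kingdon algebra $K(V,B)$.
   Context: Algebras over $F$ are unital but not necessarily associative. A formed space $(V,B)$ is a finite-dimensional $F$-vector space $V$ with a symmetric bilinear form $B$. An algebra is alternative if $x(xy)=(xx)y$ and $y(xx)=(yx)x$ for all elements $x,y$. $\mathrm{Alt}[V]$ denotes the free (unital) alternative $F$-algebra over $V$: it is alternative, contains $V$ as a subspace and $F=F1$, and each linear map from $V$ to an alternative $F$-algebra extends uniquely to an $F$-algebra homomorphism on $\mathrm{Alt}[V]$. The Kingdon algebra is $K(V,B)=\mathrm{Alt}[V]/I_B$, where $I_B$ is the two-sided ideal generated by all elements $uv+vu-B(u,v)\cdot 1$ and $(uv)w-w(vu)$ with $u,v,w\in V$. The insertion is $\iota\colon V\to K(V,B);\ v\mapsto I_B+v$, and a vector $v\in V$ is also used to denote its image $\iota(v)$ in $K(V,B)$. *)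

(* Defs.v *)
From HB Require Import structures.
From mathcomp Require Import all_boot all_order all_algebra ring_quotient.
From mathcomp Require Import boolp classical_sets.

Set Implicit Arguments.
Unset Strict Implicit.
Unset Printing Implicit Defensive.

Import GRing.Theory.
Local Open Scope ring_scope.
Local Open Scope quotient_scope.
Local Open Scope classical_set_scope.

(* MathComp rings and algebras are associative, so unital algebras that need
   not be associative get their own structure; their product is written
   x ** y, and \1 is their unit. *)

Reserved Notation "x ** y" (at level 40, left associativity).
Reserved Notation "\1".

HB.mixin Record Lmodule_isNonassocAlgebra (F : fieldType) A
    of GRing.Lmodule F A := {
  nalg_one : A;
  nalg_mul : A -> A -> A;
  nalg_mul1l : left_id nalg_one nalg_mul;
  nalg_mul1r : right_id nalg_one nalg_mul;
  nalg_mulDl : left_distributive nalg_mul +%R;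
  nalg_mulDr : right_distributive nalg_mul +%R;
  nalg_scalel : forall k x y, nalg_mul (k *: x) y = k *: nalg_mul x y;
  nalg_scaler : forall k x y, nalg_mul x (k *: y) = k *: nalg_mul x y
}.

#[short(type="nonassocAlgType")]
HB.structure Definition NonassocAlgebra (F : fieldType) :=
  {A of Lmodule_isNonassocAlgebra F A & GRing.Lmodule F A}.

Notation "x ** y" := (nalg_mul x y) : ring_scope.
Notation "\1" := nalg_one : ring_scope.

HB.mixin Record NonassocAlgebra_isAlternative (F : fieldType) A
    of NonassocAlgebra F A := {
  nalg_altl : forall x y : A, x ** (x ** y) = (x ** x) ** y;
  nalg_altr : forall x y : A, y ** (x ** x) = (y ** x) ** x
}.

#[short(type="altAlgType")]
HB.structure Definition AltAlgebra (F : fieldType) :=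
  {A of NonassocAlgebra_isAlternative F A & NonassocAlgebra F A}.

Definition is_alghom (F : fieldType) (A A' : nonassocAlgType F)
    (g : A -> A') : Prop :=
  [/\ linear g, g \1 = \1 & {morph g : x y / x ** y}].

(* Quotient of an algebra by the two-sided ideal generated by a set. *)

Section IdealQuotient.
Variables (F : fieldType) (A : nonassocAlgType F).

Definition is_ideal (I : set A) : Prop :=
  [/\ I 0,
      forall x y, I x -> I y -> I (x + y),
      forall k x, I x -> I (k *: x),
      forall x y, I y -> I (x ** y)
    & forall x y, I x -> I (x ** y)].

Definition ideal_gen (S : set A) : {pred A} :=
  fun x => `[< forall I, is_ideal I -> S `<=` I -> I x >].

Lemma ideal_genP S x :
  reflect (forall I, is_ideal I -> S `<=` I -> I x) (x \in ideal_gen S).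
Proof. exact: asboolP. Qed.

Lemma mem_ideal_gen S x : S x -> x \in ideal_gen S.
Proof. by move=> Sx; apply/ideal_genP => I _; apply. Qed.

Lemma ideal_gen_ideal S : is_ideal [set x | x \in ideal_gen S].
Proof.
split=> /= [|x y|k x|x y|x y].
- by apply/ideal_genP => I [].
- move=> /ideal_genP xS /ideal_genP yS; apply/ideal_genP => I Iid SI.
  by have [_ ID _ _ _] := Iid; apply: ID; [exact: xS|exact: yS].
- move=> /ideal_genP xS; apply/ideal_genP => I Iid SI.
  by have [_ _ IZ _ _] := Iid; apply: IZ; exact: xS.
- move=> /ideal_genP xS; apply/ideal_genP => I Iid SI.
  by have [_ _ _ IM _] := Iid; apply: IM; exact: xS.
- move=> /ideal_genP xS; apply/ideal_genP => I Iid SI.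
  by have [_ _ _ _ IM] := Iid; apply: IM; exact: xS.
Qed.

Lemma ideal_gen_zmod_closed S : zmod_closed (ideal_gen S).
Proof.
have [I0 ID IZ _ _] := ideal_gen_ideal S.
by split=> // x y xS yS; apply: ID => //; rewrite -scaleN1r; exact: IZ.
Qed.

HB.instance Definition _ (S : set A) :=
  GRing.isZmodClosed.Build A (ideal_gen S) (ideal_gen_zmod_closed S).

Variable S : set A.

Definition alg_quot : Type := Quotient.quot (ideal_gen S).
HB.instance Definition _ := GRing.Zmodule.on alg_quot.
HB.instance Definition _ := EqQuotient.on alg_quot.

Definition class_of (x : A) : alg_quot := \pi_alg_quot x.

Lemma class_ofP x y : reflect (class_of x = class_of y) (x - y \in ideal_gen S).
Proof. by rewrite Quotient.idealrBE; exact: eqP. Qed.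

Lemma class_ofK q : class_of (repr q) = q. Proof. exact: reprK. Qed.

Lemma repr_class_of x : repr (class_of x) - x \in ideal_gen S.
Proof. by apply/class_ofP; rewrite class_ofK. Qed.

Lemma class_of_ind (P : alg_quot -> Prop) :
  (forall x, P (class_of x)) -> forall q, P q.
Proof. by move=> Pc q; rewrite -(class_ofK q). Qed.

Lemma class_ofD x y : class_of (x + y) = class_of x + class_of y.
Proof. by rewrite /class_of !piE. Qed.

Definition quot_scale k (q : alg_quot) := class_of (k *: repr q).
Definition quot_mul (p q : alg_quot) := class_of (repr p ** repr q).

Lemma quot_scaleE k x : quot_scale k (class_of x) = class_of (k *: x).
Proof.
apply/class_ofP; rewrite -scalerBr; have [_ _ IZ _ _] := ideal_gen_ideal S.
exact/IZ/repr_class_of.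
Qed.

Lemma quot_mulE x y : quot_mul (class_of x) (class_of y) = class_of (x ** y).
Proof.
apply/class_ofP; have [_ ID _ IMl IMr] := ideal_gen_ideal S.
have -> : repr (class_of x) ** repr (class_of y) - x ** y =
   (repr (class_of x) - x) ** repr (class_of y) +
   x ** (repr (class_of y) - y).
  rewrite -!scaleN1r nalg_mulDl nalg_mulDr nalg_scalel nalg_scaler.
  by rewrite -addrA (addrA (- 1 *: _)) !scaleN1r addNr add0r.
by apply: ID; [exact/IMr/repr_class_of|exact/IMl/repr_class_of].
Qed.

Lemma quot_scaleA a b v : quot_scale a (quot_scale b v) = quot_scale (a * b) v.
Proof. by elim/class_of_ind: v => x; rewrite !quot_scaleE scalerA. Qed.

Lemma quot_scale1 : left_id 1 quot_scale.
Proof. by elim/class_of_ind => x; rewrite quot_scaleE scale1r. Qed.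

Lemma quot_scaleDr : right_distributive quot_scale +%R.
Proof.
move=> k; elim/class_of_ind => x; elim/class_of_ind => y.
by rewrite -class_ofD !quot_scaleE scalerDr class_ofD.
Qed.

Lemma quot_scaleDl v : {morph quot_scale^~ v : a b / a + b}.
Proof.
by elim/class_of_ind: v => x a b; rewrite !quot_scaleE scalerDl class_ofD.
Qed.

HB.instance Definition _ := GRing.Zmodule_isLmodule.Build F alg_quot
  quot_scaleA quot_scale1 quot_scaleDr quot_scaleDl.

Lemma class_ofZ k x : class_of (k *: x) = k *: class_of x.
Proof. exact/esym/quot_scaleE. Qed.

Lemma quot_mul1l : left_id (class_of \1) quot_mul.
Proof. by elim/class_of_ind => x; rewrite quot_mulE nalg_mul1l. Qed.

Lemma quot_mul1r : right_id (class_of \1) quot_mul.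
Proof. by elim/class_of_ind => x; rewrite quot_mulE nalg_mul1r. Qed.

Lemma quot_mulDl : left_distributive quot_mul +%R.
Proof.
elim/class_of_ind => x; elim/class_of_ind => y; elim/class_of_ind => z.
by rewrite -class_ofD !quot_mulE nalg_mulDl class_ofD.
Qed.

Lemma quot_mulDr : right_distributive quot_mul +%R.
Proof.
elim/class_of_ind => x; elim/class_of_ind => y; elim/class_of_ind => z.
by rewrite -class_ofD !quot_mulE nalg_mulDr class_ofD.
Qed.

Lemma quot_scalel k p q : quot_mul (k *: p) q = k *: quot_mul p q.
Proof.
elim/class_of_ind: p => x; elim/class_of_ind: q => y.
by rewrite -class_ofZ !quot_mulE nalg_scalel class_ofZ.
Qed.

Lemma quot_scaler k p q : quot_mul p (k *: q) = k *: quot_mul p q.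
Proof.
elim/class_of_ind: p => x; elim/class_of_ind: q => y.
by rewrite -class_ofZ !quot_mulE nalg_scaler class_ofZ.
Qed.

HB.instance Definition _ := Lmodule_isNonassocAlgebra.Build F alg_quot
  quot_mul1l quot_mul1r quot_mulDl quot_mulDr quot_scalel quot_scaler.

Lemma class_ofM x y : class_of (x ** y) = class_of x ** class_of y.
Proof. exact/esym/quot_mulE. Qed.

Lemma class_of_alghom : is_alghom class_of.
Proof.
split=> [k x y||x y]; [by rewrite class_ofD class_ofZ|by []|exact: class_ofM].
Qed.

End IdealQuotient.

Section AltQuotient.
Variables (F : fieldType) (A : altAlgType F) (S : set A).

Lemma quot_altl (x y : alg_quot S) : x ** (x ** y) = (x ** x) ** y.
Proof.
elim/class_of_ind: x => x; elim/class_of_ind: y => y.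
by rewrite -!class_ofM nalg_altl.
Qed.

Lemma quot_altr (x y : alg_quot S) : y ** (x ** x) = (y ** x) ** x.
Proof.
elim/class_of_ind: x => x; elim/class_of_ind: y => y.
by rewrite -!class_ofM nalg_altr.
Qed.

HB.instance Definition _ := NonassocAlgebra_isAlternative.Build F (alg_quot S)
  quot_altl quot_altr.

End AltQuotient.

(* The free alternative algebra over V: formal expressions in the vectors of V,
   modulo the least congruence that imposes the axioms of alternative algebras
   and the linearity of v |-> TVec v. *)

Section FreeAlternative.
Variables (F : fieldType) (V : lmodType F).

Inductive term : Type :=
  | TZero
  | TOne
  | TVec of V
  | TAdd of term & term
  | TScale of F & term
  | TMul of term & term.

Inductive teq : term -> term -> Prop :=
  | teq_refl x : teq x x
  | teq_sym x y : teq x y -> teq y x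
  | teq_trans x y z : teq x y -> teq y z -> teq x z
  | teq_add x x' y y' : teq x x' -> teq y y' -> teq (TAdd x y) (TAdd x' y')
  | teq_scale k x x' : teq x x' -> teq (TScale k x) (TScale k x')
  | teq_mul x x' y y' : teq x x' -> teq y y' -> teq (TMul x y) (TMul x' y')
  | teq_addA x y z : teq (TAdd x (TAdd y z)) (TAdd (TAdd x y) z)
  | teq_addC x y : teq (TAdd x y) (TAdd y x)
  | teq_add0 x : teq (TAdd TZero x) x
  | teq_scale0 x : teq (TScale 0 x) TZero
  | teq_scale1 x : teq (TScale 1 x) x
  | teq_scaleA k l x : teq (TScale k (TScale l x)) (TScale (k * l) x)
  | teq_scaleDr k x y :
      teq (TScale k (TAdd x y)) (TAdd (TScale k x) (TScale k y))
  | teq_scaleDl k l x :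
      teq (TScale (k + l) x) (TAdd (TScale k x) (TScale l x))
  | teq_mul1l x : teq (TMul TOne x) x
  | teq_mul1r x : teq (TMul x TOne) x
  | teq_mulDl x y z : teq (TMul (TAdd x y) z) (TAdd (TMul x z) (TMul y z))
  | teq_mulDr x y z : teq (TMul x (TAdd y z)) (TAdd (TMul x y) (TMul x z))
  | teq_scalel k x y : teq (TMul (TScale k x) y) (TScale k (TMul x y))
  | teq_scaler k x y : teq (TMul x (TScale k y)) (TScale k (TMul x y))
  | teq_altl x y : teq (TMul x (TMul x y)) (TMul (TMul x x) y)
  | teq_altr x y : teq (TMul y (TMul x x)) (TMul (TMul y x) x)
  | teq_vecD u v : teq (TVec (u + v)) (TAdd (TVec u) (TVec v))
  | teq_vecZ k v : teq (TVec (k *: v)) (TScale k (TVec v)).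

HB.instance Definition _ := gen_eqMixin term.
HB.instance Definition _ := gen_choiceMixin term.

Definition teqb : rel term := fun x y => `[< teq x y >].

Lemma teqb_equiv : equiv_class_of teqb.
Proof.
split=> [x|x y|y x z]; first exact/asboolP/teq_refl.
- by apply/asboolP/asboolP; exact: teq_sym.
- by move=> /asboolP xy /asboolP yz; apply/asboolP/(teq_trans xy yz).
Qed.

Canonical teqb_equiv_rel := EquivRelPack teqb_equiv.
Canonical teqb_encModRel := defaultEncModRel teqb.

Definition free_alt : Type := {eq_quot teqb}.
HB.instance Definition _ := Choice.on free_alt.
HB.instance Definition _ := EqQuotient.on free_alt.

Local Notation cls := (\pi_free_alt).

Lemma cls_eqP x y : cls x = cls y <-> teq x y.
Proof. by split=> [/eqmodP/asboolP|xy]; [|exact/eqmodP/asboolP]. Qed.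

Lemma teq_repr x : teq (repr (cls x)) x.
Proof. by apply/cls_eqP; rewrite reprK. Qed.

Lemma free_alt_ind (P : free_alt -> Prop) :
  (forall x, P (cls x)) -> forall q, P q.
Proof. by move=> Pc q; rewrite -(reprK q). Qed.

Definition fadd (p q : free_alt) : free_alt := cls (TAdd (repr p) (repr q)).
Definition fscale k (p : free_alt) : free_alt := cls (TScale k (repr p)).
Definition fmul (p q : free_alt) : free_alt := cls (TMul (repr p) (repr q)).
Definition fopp := fscale (-1).

Lemma faddE x y : fadd (cls x) (cls y) = cls (TAdd x y).
Proof. by apply/cls_eqP/teq_add; exact: teq_repr. Qed.
Lemma fscaleE k x : fscale k (cls x) = cls (TScale k x).
Proof. by apply/cls_eqP/teq_scale; exact: teq_repr. Qed.
Lemma fmulE x y : fmul (cls x) (cls y) = cls (TMul x y).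
Proof. by apply/cls_eqP/teq_mul; exact: teq_repr. Qed.

Let fE := (faddE, fscaleE, fmulE).

Lemma faddA : associative fadd.
Proof.
by do 3!elim/free_alt_ind => ?; rewrite !fE; exact/cls_eqP/teq_addA.
Qed.
Lemma faddC : commutative fadd.
Proof.
by do 2!elim/free_alt_ind => ?; rewrite !fE; exact/cls_eqP/teq_addC.
Qed.
Lemma fadd0 : left_id (cls TZero) fadd.
Proof. by elim/free_alt_ind => ?; rewrite !fE; exact/cls_eqP/teq_add0. Qed.
Lemma faddN : left_inverse (cls TZero) fopp fadd.
Proof.
elim/free_alt_ind => x; rewrite /fopp !fE; apply/cls_eqP.
apply: teq_trans (teq_scale0 x); rewrite -(addNr 1).
apply: teq_trans (teq_sym (teq_scaleDl _ _ _)).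
by apply: teq_add; [exact: teq_refl|exact/teq_sym/teq_scale1].
Qed.

HB.instance Definition _ :=
  GRing.isZmodule.Build free_alt faddA faddC fadd0 faddN.

Lemma fscaleA k l x : fscale k (fscale l x) = fscale (k * l) x.
Proof. by elim/free_alt_ind: x => ?; rewrite !fE; exact/cls_eqP/teq_scaleA. Qed.
Lemma fscale1 : left_id 1 fscale.
Proof. by elim/free_alt_ind => ?; rewrite !fE; exact/cls_eqP/teq_scale1. Qed.
Lemma fscaleDr : right_distributive fscale +%R.
Proof.
move=> k; do 2!elim/free_alt_ind => ?.
by rewrite /+%R /= !fE; exact/cls_eqP/teq_scaleDr.
Qed.
Lemma fscaleDl x : {morph fscale^~ x : k l / k + l}.
Proof.
elim/free_alt_ind: x => ? k l.
by rewrite [RHS]/+%R /= !fE; exact/cls_eqP/teq_scaleDl.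
Qed.

HB.instance Definition _ := GRing.Zmodule_isLmodule.Build F free_alt
  fscaleA fscale1 fscaleDr fscaleDl.

Lemma fmul1l : left_id (cls TOne) fmul.
Proof. by elim/free_alt_ind => ?; rewrite !fE; exact/cls_eqP/teq_mul1l. Qed.
Lemma fmul1r : right_id (cls TOne) fmul.
Proof. by elim/free_alt_ind => ?; rewrite !fE; exact/cls_eqP/teq_mul1r. Qed.
Lemma fmulDl : left_distributive fmul +%R.
Proof.
do 3!elim/free_alt_ind => ?.
by rewrite /+%R /= !fE; exact/cls_eqP/teq_mulDl.
Qed.
Lemma fmulDr : right_distributive fmul +%R.
Proof.
do 3!elim/free_alt_ind => ?.
by rewrite /+%R /= !fE; exact/cls_eqP/teq_mulDr.
Qed.
Lemma fscalel k x y : fmul (k *: x) y = k *: fmul x y.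
Proof.
elim/free_alt_ind: x => x; elim/free_alt_ind: y => y.
by rewrite /*:%R /= !fE; exact/cls_eqP/teq_scalel.
Qed.
Lemma fscaler k x y : fmul x (k *: y) = k *: fmul x y.
Proof.
elim/free_alt_ind: x => x; elim/free_alt_ind: y => y.
by rewrite /*:%R /= !fE; exact/cls_eqP/teq_scaler.
Qed.

HB.instance Definition _ := Lmodule_isNonassocAlgebra.Build F free_alt
  fmul1l fmul1r fmulDl fmulDr fscalel fscaler.

Lemma faltl (x y : free_alt) : x ** (x ** y) = (x ** x) ** y.
Proof.
elim/free_alt_ind: x => x; elim/free_alt_ind: y => y.
by rewrite /nalg_mul /= !fE; exact/cls_eqP/teq_altl.
Qed.
Lemma faltr (x y : free_alt) : y ** (x ** x) = (y ** x) ** x.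
Proof.
elim/free_alt_ind: x => x; elim/free_alt_ind: y => y.
by rewrite /nalg_mul /= !fE; exact/cls_eqP/teq_altr.
Qed.

HB.instance Definition _ := NonassocAlgebra_isAlternative.Build F free_alt
  faltl faltr.

Definition free_in (v : V) : free_alt := cls (TVec v).

Lemma free_in_linear : linear free_in.
Proof.
move=> k u v; rewrite /free_in.
rewrite [RHS](_ : _ = fadd (fscale k (cls (TVec u))) (cls (TVec v))) // !fE.
apply/cls_eqP; apply: teq_trans (teq_vecD _ _) _.
by apply: teq_add; [exact: teq_vecZ|exact: teq_refl].
Qed.

HB.instance Definition _ :=
  GRing.isLinear.Build F V free_alt _ free_in free_in_linear.

Section Eval.
Variables (A : altAlgType F) (f : {linear V -> A}).

Fixpoint teval (t : term) : A :=
  match t with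
  | TZero => 0
  | TOne => \1
  | TVec v => f v
  | TAdd x y => teval x + teval y
  | TScale k x => k *: teval x
  | TMul x y => teval x ** teval y
  end.

Lemma teval_teq x y : teq x y -> teval x = teval y.
Proof.
elim=> //= *; do ?congruence.
- exact: addrA.
- exact: addrC.
- exact: add0r.
- exact: scale0r.
- exact: scale1r.
- exact: scalerA.
- exact: scalerDr.
- exact: scalerDl.
- exact: nalg_mul1l.
- exact: nalg_mul1r.
- exact: nalg_mulDl.
- exact: nalg_mulDr.
- exact: nalg_scalel.
- exact: nalg_scaler.
- exact: nalg_altl.
- exact: nalg_altr.
- exact: linearD.
- exact: linearZ.
Qed.

Definition free_lift (q : free_alt) : A := teval (repr q).

Lemma free_liftE x : free_lift (cls x) = teval x.
Proof. exact/teval_teq/teq_repr. Qed.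

Theorem free_alt_universal :
  exists! g : free_alt -> A, is_alghom g /\ forall v, g (free_in v) = f v.
Proof.
exists free_lift; split.
  split; last by move=> v; rewrite free_liftE.
  split=> [k x y||x y]; last 2 first.
  - by rewrite free_liftE.
  - elim/free_alt_ind: x => x; elim/free_alt_ind: y => y.
    by rewrite {1}/nalg_mul /= fE !free_liftE.
  elim/free_alt_ind: x => x; elim/free_alt_ind: y => y.
  by rewrite {1}/+%R {1}/*:%R /= !fE !free_liftE.
move=> g [[glin g1 gM] gf]; apply: funext; elim/free_alt_ind => x.
rewrite free_liftE; pose G : {linear free_alt -> A} :=
  HB.pack g (GRing.isLinear.Build F free_alt A _ g glin).
have gD p q : g (p + q) = g p + g q := linearD G p q.
have gZ k p : g (k *: p) = k *: g p := linearZ_LR G k p.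
elim: x => //= [|v|x -> y ->|k x ->|x -> y ->].
- exact/esym/(linear0 G).
- exact/esym/gf.
- by rewrite -gD {1}/+%R /= fE.
- by rewrite -gZ {1}/*:%R /= fE.
- by rewrite -gM {1}/nalg_mul /= fE.
Qed.

End Eval.
End FreeAlternative.

Arguments free_alt {F} V.

(* F1 + V is a direct sum inside free_alt V: map to F (+) V with V V = 0. *)

Section Embedding.
Variables (F : fieldType) (V : lmodType F).

Definition null_ext : Type := (F^o * V)%type.
HB.instance Definition _ := GRing.Lmodule.on null_ext.

Definition null_mul (p q : null_ext) : null_ext :=
  (p.1 * q.1, p.1 *: q.2 + q.1 *: p.2).

Lemma null_mulC : commutative null_mul.
Proof. by move=> p q; rewrite /null_mul mulrC addrC. Qed.

Lemma null_mulA : associative null_mul.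
Proof.
move=> [p u] [q v] [r w]; rewrite /null_mul /= mulrA !scalerDr !scalerA addrA.
by rewrite (mulrC r p) (mulrC r q).
Qed.

Lemma null_mul1l : left_id ((1, 0) : null_ext) null_mul.
Proof. by case=> p u; rewrite /null_mul /= mul1r scale1r scaler0 addr0. Qed.

Lemma null_mul1r : right_id ((1, 0) : null_ext) null_mul.
Proof. by move=> p; rewrite null_mulC null_mul1l. Qed.

Lemma null_mulDl : left_distributive null_mul +%R.
Proof.
move=> [p u] [q v] [r w]; congr (_, _); rewrite /= ?mulrDl //.
by rewrite scalerDl scalerDr addrACA.
Qed.

Lemma null_mulDr : right_distributive null_mul +%R.
Proof. by move=> p q r; rewrite !(null_mulC p) null_mulDl. Qed.

Lemma null_scalel k p q : null_mul (k *: p) q = k *: null_mul p q.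
Proof.
case: p q => [p u] [q v]; congr (_, _); rewrite /= -?mulrA //.
by rewrite scalerDr !scalerA (mulrC q).
Qed.

Lemma null_scaler k p q : null_mul p (k *: q) = k *: null_mul p q.
Proof. by rewrite !(null_mulC p) null_scalel. Qed.

HB.instance Definition _ := Lmodule_isNonassocAlgebra.Build F null_ext
  null_mul1l null_mul1r null_mulDl null_mulDr null_scalel null_scaler.

HB.instance Definition _ := NonassocAlgebra_isAlternative.Build F null_ext
  (fun x y => null_mulA x x y) (fun x y => null_mulA y x x).

Definition null_in (v : V) : null_ext := (0, v).

Lemma null_in_linear : linear null_in.
Proof. by move=> k u v; congr (_, _); rewrite /= scaler0 addr0. Qed.

HB.instance Definition _ :=
  GRing.isLinear.Build F V null_ext _ null_in null_in_linear.

Lemma free_alt_embed :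
  injective (fun p : F * V => p.1 *: \1 + free_in p.2 : free_alt V).
Proof.
have [g [[[glin g1 _] gf] _]] := free_alt_universal null_in.
have gE (p : F * V) : g (p.1 *: \1 + free_in p.2) = p.
  rewrite glin g1 gf; case: p => p u.
  by congr (_, _); rewrite /= ?scaler0 ?add0r // addr0 -[RHS]mulr1.
by move=> p q /(congr1 g); rewrite !gE.
Qed.

End Embedding.

Section Kingdon.
Variables (F : fieldType) (V : vectType F) (B : {symmetric V}).

Definition kingdon_rel : set (free_alt V) :=
  [set x | (exists u v, x = free_in u ** free_in v + free_in v ** free_in u
                            - B u v *: \1)
        \/ (exists u v w, x = (free_in u ** free_in v) ** free_in w
                              - free_in w ** (free_in v ** free_in u))].

Definition kingdon : altAlgType F := alg_quot kingdon_rel.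

Definition kingdon_in (v : V) : kingdon := class_of kingdon_rel (free_in v).

End Kingdon.

(* Main.v *)
(* With u v + v u = B(u, v) and a (b c) = (c b) a, the left-hand side is
   (a b) c + (c b) a = B(a, b) c + B(b, c) a - ((b a) c + (b c) a), and the
   linearized right alternative law gives
   (b a) c + (b c) a = b (a c + c a) = B(c, a) b. *)

Require Import Defs.
From mathcomp Require Import all_boot all_order all_algebra.

Set Implicit Arguments.
Unset Strict Implicit.
Unset Printing Implicit Defensive.

Import GRing.Theory.
Local Open Scope ring_scope.

(** Polarization of [nalg_altr] at [x + z]: the pure terms in [x] and in [z] cancel from both
    sides. *)
Lemma nalg_altr_linearized (F : fieldType) (A : altAlgType F) (x y z : A) :
  (y ** x) ** z + (y ** z) ** x = y ** (x ** z + z ** x).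
Proof.
have := nalg_altr (x + z) y.
rewrite !(nalg_mulDl, nalg_mulDr) !nalg_altr -!addrA => /addrI.
by rewrite !addrA => /addIr ->; rewrite addrC.
Qed.

Section KingdonRelations.
Variables (F : fieldType) (V : vectType F) (B : {symmetric V}).
Local Notation i := (kingdon_in B).

Lemma kingdon_anticomm (u v : V) : i u ** i v + i v ** i u = B u v *: \1.
Proof.
rewrite /kingdon_in -!class_ofM -class_ofD.
(* The quotient's unit is by definition the class of [\1], so the scalar term also becomes a
   class. *)
rewrite -[\1]/(class_of (kingdon_rel B) \1) -class_ofZ.
by apply/class_ofP/mem_ideal_gen; left; exists u, v.
Qed.

Lemma kingdon_rev (u v w : V) : (i u ** i v) ** i w = i w ** (i v ** i u).
Proof.
(* Inner products become classes first, so that the outer ones have classes as factors. *)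
rewrite /kingdon_in -(class_ofM _ (free_in u)) -(class_ofM _ (free_in v)).
rewrite -!class_ofM; apply/class_ofP/mem_ideal_gen; right.
by exists u, v, w.
Qed.

Lemma kingdon_swap (u v w : V) :
  (i u ** i v) ** i w = B u v *: i w - (i v ** i u) ** i w.
Proof.
have <- : (i u ** i v + i v ** i u) ** i w = B u v *: i w.
  by rewrite kingdon_anticomm nalg_scalel nalg_mul1l.
by rewrite nalg_mulDl addrK.
Qed.

End KingdonRelations.

Theorem theorem3p8 (F : fieldType) (two_unit : (2%:R : F) \is a GRing.unit)
    (V : vectType F) (B : {symmetric V}) (a b c : V) :
  let i := kingdon_in B in
  (i a ** i b) ** i c + i a ** (i b ** i c)
    = B b c *: i a - B c a *: i b + B a b *: i c.
Proof.
(* Linearized law with [i b] as the left factor. *)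
move=> i; have Ebac : (i b ** i c) ** i a + (i b ** i a) ** i c = B c a *: i b.
  by rewrite nalg_altr_linearized kingdon_anticomm nalg_scaler nalg_mul1r.
have Eabc := kingdon_swap B a b c.
have Ebca := kingdon_swap B b c a.
(* Expanding [B c a *: i b] on the right lets [B b c *: i a] cancel there; both sides become
   [(cb)a - (ba)c + B(a,b)c]. *)
rewrite -(kingdon_rev B c b a) Eabc -Ebac Ebca opprD addrA opprB.
by rewrite [B b c *: _ + _]addrC subrK [LHS]addrC addrA [RHS]addrAC.
Qed.
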